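(* For every natural number $n\ge 1$ and every $\boldsymbol{\Delta}^1_n$-measurable function $f:\mathcal{N}\to\mathcal{N}$ there is some $\alpha\in\mathcal{N}$ such that the set \[ \mathrm{G}^{\mathcal{N}}_n(\alpha)\,\triangle\,\mathrm{U}^{\mathcal{N}}(f(\alpha)) \] is non-meager in $\mathcal{N}$.
   Context: Notation. $\omega=\{0,1,2,\dots\}$; $\mathcal{N}=\omega^\omega$ is the Baire space with the product topology. $\triangle$ denotes symmetric difference. For $P\subseteq X\times Y$ and $x\in X$, the section $\{y\in Y : (x,y)\in P\}$ is denoted $P(x)$; we write $P(x,y)$ for $(x,y)\in P$. $\boldsymbol{\Delta}^1_n=\boldsymbol{\Sigma}^1_n\cap\boldsymbol{\Pi}^1_n$ are the usual (boldface) projective classes. A function $f:\mathcal{N}\to\mathcal{N}$ is $\boldsymbol{\Delta}^1_n$-measurable if $f^{-1}[V]$ is $\boldsymbol{\Delta}^1_n$ for every open $V\subseteq\mathcal{N}$. Coding of finite sequences. For $n\ge 1$, $\langle u_0,\dots,u_{n-1}\rangle=p_0^{u_0+1}\cdots p_{n-1}^{u_{n-1}+1}$, where $p_0<p_1<\dots$ are the primes; $\langle\emptyset\rangle=1$. If $s=\langle u_0,\dots,u_{n-1}\rangle$ and $i<n$, then $(s)_i:=u_i$; if $i\ge n$ or $s$ is not in the image of $\langle\cdot\rangle$, then $(s)_i:=0$. Put $q_k=(k)_0/((k)_1+1)$, an enumeration of the non-negative rationals. Basic open sets. For every Polish space $\mathcal{X}$ (including products) a compatible metric $d_{\mathcal{X}}$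 and a dense sequence $(r^{\mathcal{X}}_i)_{i\in\omega}$ are fixed (a recursive presentation when the space is recursively presented), and $N(\mathcal{X},s)$ is the open $d_{\mathcal{X}}$-ball with center $r^{\mathcal{X}}_{(s)_0}$ and radius $q_{(s)_1}$ (the empty set if the radius is $0$). For $\mathcal{N}$ the choice is: $d_{\mathcal{N}}(\alpha,\beta)=(n+1)^{-1}$ with $n$ least such that $\alpha(n)\ne\beta(n)$ if $\alpha\ne\beta$, $d_{\mathcal{N}}(\alpha,\alpha)=0$, and $r^{\mathcal{N}}_s(i)=(s)_i$. Universal sets. For every Polish space $\mathcal{X}$ define $\mathrm{U}^{\mathcal{X}},\mathrm{F}^{\mathcal{X}},\mathrm{G}^{\mathcal{X}}_n\subseteq\mathcal{N}\times\mathcal{X}$ ($n\ge 1$) by $\mathrm{U}^{\mathcal{X}}(\alpha,x)\iff(\exists n\in\omega)[x\in N(\mathcal{X},\alpha(n))]$; $\mathrm{F}^{\mathcal{X}}(\alpha,x)\iff\neg\,\mathrm{U}^{\mathcal{X}}(\alpha,x)$; $\mathrm{G}^{\mathcal{X}}_1(\alpha,x)\iff(\exists\gamma\in\mathcal{N})\,\mathrm{F}^{\mathcal{X}\times\mathcal{N}}(\alpha,x,\gamma)$; $\mathrm{G}^{\mathcal{X}}_{n+1}(\alpha,x)\iff(\exists\gamma\in\mathcal{N})\,\neg\,\mathrm{G}^{\mathcal{X}\times\mathcal{N}}_n(\alpha,x,\gamma)$. Thus $\mathrm{U}^{\mathcal{X}}$ is universal for the open subsets of $\mathcal{X}$ and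 $\mathrm{G}^{\mathcal{X}}_n$ is universal for the $\boldsymbol{\Sigma}^1_n$ subsets of $\mathcal{X}$. *)

(* Defs.v *)
From HB Require Import structures.
From mathcomp Require Import all_boot all_order all_algebra.
From mathcomp Require Import all_classical all_reals topology.

Set Implicit Arguments.
Unset Strict Implicit.
Unset Printing Implicit Defensive.

Import Order.TTheory GRing.Theory Num.Theory.

Local Open Scope classical_set_scope.
Local Open Scope ring_scope.

Definition baire : Type := prod_topology (fun _ : nat => nat).

HB.instance Definition _ := Pointed.on baire.
HB.instance Definition _ := Nbhs.on baire.
HB.instance Definition _ := Topological.on baire.

HB.instance Definition _ (T U : pointedType) :=
  isPointed.Build (T * U)%type (point, point).
HB.instance Definition _ (T U : ptopologicalType) := Pointed.on (T * U)%type.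

Lemma ex_prime_above (m : nat) : exists p, (m < p)%N && prime p.
Proof. by have [p mp pp] := prime_above m; exists p; rewrite mp. Qed.

Fixpoint nth_prime (n : nat) : nat :=
  if n is m.+1 then ex_minn (ex_prime_above (nth_prime m)) else 2.

Definition seq_code (u : seq nat) : nat :=
  \prod_(i < size u) nth_prime i ^ (nth 0 u i).+1.

(* seq_code is injective by unique factorization, so this is its inverse,
   extended by [::] outside of its range. *)
Definition seq_decode (s : nat) : seq nat :=
  xget [::] [set u | seq_code u = s].

(* (s)_i: the default value of nth covers both i >= n and s outside of the
   range of seq_code. *)
Definition entry (s i : nat) : nat := nth 0 (seq_decode s) i.

Definition radius (R : realType) (k : nat) : R :=
  (entry k 0)%:R / (entry k 1).+1%:R.

Section metrics.
Context {R : realType}.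

Definition is_metric (X : Type) (d : X -> X -> R) : Prop :=
  [/\ forall x, d x x = 0,
      forall x y, d x y = 0 -> x = y,
      forall x y, d x y = d y x &
      forall x y z, d x z <= d x y + d y z].

Definition compatible_metric (X : topologicalType) (d : X -> X -> R) : Prop :=
  is_metric d /\
  forall A : set X, open A <->
    forall x, A x -> exists2 e : R, 0 < e & [set y | d x y < e] `<=` A.

Definition complete_metric (X : topologicalType) (d : X -> X -> R) : Prop :=
  forall u : nat -> X,
    (forall e : R, 0 < e -> exists N : nat, forall m n : nat,
       (N <= m)%N -> (N <= n)%N -> d (u m) (u n) < e) ->
    exists l : X, u @ \oo --> l.

End metrics.

Definition polish (R : realType) (X : topologicalType) : Prop :=
  (exists d : X -> X -> R, compatible_metric d /\ complete_metric d) /\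
  (exists r : nat -> X, dense (range r)).

Definition baire_dist (R : realType) (a b : baire) : R :=
  if pselect (exists n, a n != b n) is left ab
  then ((ex_minn ab).+1%:R)^-1 else 0.

Definition baire_seq (s : nat) : baire := fun i => entry s i.

(* A choice of a compatible metric and of a dense sequence for every (nonempty)
   Polish space, which is the prescribed one for the Baire space. The values on
   the spaces that are not Polish are irrelevant. Spaces are pointed only because
   an empty space admits no sequence. *)
Record presentation (R : realType) := Presentation {
  pdist : forall X : ptopologicalType, X -> X -> R ;
  pseq : forall X : ptopologicalType, nat -> X ;
  pdist_compatible : forall X : ptopologicalType,
    polish R X -> compatible_metric (@pdist X) ;
  pseq_dense : forall X : ptopologicalType,
    polish R X -> dense (range (@pseq X)) ;
  pdist_baire : forall a b : baire, pdist a b = baire_dist R a b ;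
  pseq_baire : forall s : nat, pseq baire s = baire_seq s }.

Definition basic_open (R : realType) (S : presentation R)
    (X : ptopologicalType) (s : nat) : set X :=
  [set x | pdist S (pseq S X (entry s 0)) x < radius R (entry s 1)].
Arguments basic_open {R} S X s.

Definition univ_U (R : realType) (S : presentation R) (X : ptopologicalType) :
    set (baire * X) :=
  [set ax | exists n : nat, basic_open S X (ax.1 n) ax.2].
Arguments univ_U {R} S X.

Definition univ_F (R : realType) (S : presentation R) (X : ptopologicalType) :
    set (baire * X) :=
  ~` univ_U S X.
Arguments univ_F {R} S X.

(* Only n >= 1 is meaningful. *)
Fixpoint univ_G (R : realType) (S : presentation R) (n : nat)
    (X : ptopologicalType) : set (baire * X) :=
  match n with
  | 0 => set0
  | 1 => [set ax | exists g : baire,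
            univ_F S (X * baire)%type (ax.1, (ax.2, g))]
  | (_.+1 as m).+1 => [set ax | exists g : baire,
            ~ @univ_G R S m (X * baire)%type (ax.1, (ax.2, g))]
  end.
Arguments univ_G {R} S n X.

(* The boldface classes of projective subsets of X: projections along the Baire
   space of closed sets, then of complements of sets of the previous level.
   Only n >= 1 is meaningful. *)
Fixpoint Sigma1 (n : nat) (X : topologicalType) : set (set X) :=
  match n with
  | 0 => set0
  | 1 => [set A | exists2 C : set (X * baire), closed C & A = fst @` C]
  | (_.+1 as m).+1 => [set A | exists2 C : set (X * baire),
            Sigma1 m (~` C) & A = fst @` C]
  end.

Definition Pi1 (n : nat) (X : topologicalType) : set (set X) :=
  [set A | Sigma1 n (~` A)].

Definition Delta1 (n : nat) (X : topologicalType) : set (set X) :=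
  @Sigma1 n X `&` @Pi1 n X.

Definition Delta1_measurable (n : nat) (f : baire -> baire) : Prop :=
  forall V : set baire, open V -> Delta1 n (f @^-1` V).

Definition nowhere_dense (X : topologicalType) (A : set X) : Prop :=
  interior (closure A) = set0.

Definition meager (X : topologicalType) (A : set X) : Prop :=
  exists2 F : nat -> set X,
    forall i, nowhere_dense (F i) & A = \bigcup_i F i.

(* Main.v *)
Require Import Defs.
From HB Require Import structures.
From mathcomp Require Import all_boot all_order all_algebra.
From mathcomp Require Import all_classical all_reals topology.
Import Order.TTheory GRing.Theory Num.Theory.
Local Open Scope classical_set_scope.

(* Substituting a continuous map in a universal set amounts to substituting one
   in its parameter, so there is a continuous g such that G_n(g(a)) is the whole
   space if G_n(a, a) and is empty otherwise. If every symmetric difference were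
   meager, the Baire category theorem would make G_n(a, a) equivalent to
   U(f(g(a))) being nonempty, which is an open condition on f(g(a)). As f is
   Delta^1_n-measurable, its negation would then be G_n(e, g(a)) for some e, hence
   G_n(g'(e), a) for some g'; taking a = g'(e) is contradictory. *)

(** * Cylinders and the Baire category theorem in the Baire space *)

Definition cylinder (a : baire) (n : nat) : set baire :=
  [set b | forall i, (i < n)%N -> b i = a i].

Lemma cylinder_le (a : baire) m n : (m <= n)%N -> cylinder a n `<=` cylinder a m.
Proof. by move=> mn b ab i im; apply: ab; exact: leq_trans mn. Qed.

Lemma nbhs_coord (a : baire) i : nbhs a [set b : baire | b i = a i].
Proof.
have := @proj_continuous nat (fun _ => nat) i a [set a i].
by apply; apply/principal_filterP.
Qed.

Lemma filter_cylinder (F : set_system baire) (FF : Filter F) (a : baire) n :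
  (forall i, F [set b : baire | b i = a i]) -> F (cylinder a n).
Proof.
move=> Fa; elim: n => [|n IHn]; first by apply: filterS filterT => b _ i.
apply: filterS (filterI IHn (Fa n)) => b [abn abi] i.
by rewrite ltnS leq_eqVlt => /predU1P[->//|/abn].
Qed.

Lemma nbhs_cylinder (a : baire) n : nbhs a (cylinder a n).
Proof. by apply: filter_cylinder => i; exact: nbhs_coord. Qed.

(** The cylinders around [a] are a filter base. The product topology is the supremum of the
    topologies induced by the coordinates, so that filter converges to [a] once each coordinate is
    fixed by some cylinder. *)
Lemma nbhs_baireP (a : baire) (A : set baire) :
  nbhs a A <-> exists n, cylinder a n `<=` A.
Proof.
split=> [|[n anA]]; last exact: filterS anA (nbhs_cylinder a n).
pose F : set_system baire := filter_from [set: nat] (cylinder a).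
have FF : Filter F.
  apply: filter_from_filter; first by exists 0%N.
  move=> m n _ _; exists (maxn m n) => // b ab; split=> i lti; apply: ab.
    by apply: leq_trans lti _; exact: leq_maxl.
  by apply: leq_trans lti _; exact: leq_maxr.
suff Fa : F --> a by move=> /Fa[n _]; exists n.
apply/cvg_sup => i B [C [[D oD <-] Da] DB].
exists i.+1 => // b ab; apply: DB => /=.
by rewrite ab.
Qed.

Lemma cvg_baire (F : set_system baire) (FF : Filter F) (a : baire) :
  (forall i, F [set b : baire | b i = a i]) -> F --> a.
Proof.
move=> Fa A /nbhs_baireP[n aA].
exact: (@filterS _ F FF _ _ aA (filter_cylinder _ _ _ _ Fa)).
Qed.

Lemma continuous_baire (g : baire -> baire) :
  (forall a i, exists n, forall b, cylinder a n b -> g b i = g a i) ->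
  continuous g.
Proof.
move=> gi a; apply: cvg_baire => i; have [n agi] := gi a i.
by apply: filterS (nbhs_cylinder a n) => b /agi.
Qed.

(** Baire category: from a point of [O], build decreasing cylinders whose lengths grow, the first
    inside [O] and each later one missing one more [F k]; their common point lies in [O] but in no
    [F k]. *)
Lemma meager_open_eq0 (A O : set baire) :
  meager A -> open O -> O `<=` A -> O = set0.
Proof.
move=> [F ndF ->] oO OF; apply/seteqP; split=> // x0 Ox0.
have [n0 n0O] : exists n, cylinder x0 n `<=` O.
  by apply/nbhs_baireP; exact: open_nbhs_nbhs.
have step (k : nat) (xn : baire * nat) : {yp : baire * nat |
    [/\ cylinder xn.1 xn.2 yp.1, (xn.2 < yp.2)%N &
        cylinder yp.1 yp.2 `<=` ~` F k]}.
  apply: cid; case: xn => x n /=.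
  have /existsNP[y /not_implyP[xy]] : ~ cylinder x n `<=` closure (F k).
    move=> xF; have : interior (closure (F k)) x.
      by apply/nbhs_baireP; exists n.
    by rewrite ndF.
  move=> /existsNP[B /not_implyP[/nbhs_baireP[m mB]]] FB.
  (* Length [m] keeps the cylinder off [F k]; length [n.+1] forces strict growth, so that the limit
     is determined. *)
  exists (y, maxn m n.+1); split=> //=; first exact: leq_maxr.
  move=> z /(cylinder_le _ _ _ (leq_maxl _ _)) /mB Bz Fz; apply: FB.
  by exists z.
pose u := fix u k := if k is m.+1 then sval (step m (u m)) else (x0, n0).
have uS k : [/\ cylinder (u k).1 (u k).2 (u k.+1).1,
    ((u k).2 < (u k.+1).2)%N & cylinder (u k.+1).1 (u k.+1).2 `<=` ~` F k].
  exact: (svalP (step k (u k))).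
have u_ge k : (k <= (u k).2)%N.
  by elim: k => // k IHk; have [_ + _] := uS k; exact: leq_ltn_trans.
have u_cyl k m : cylinder (u k).1 (u k).2 (u (k + m)%N).1 /\
    ((u k).2 <= (u (k + m)%N).2)%N.
  elim: m => [|m [IH1 IH2]]; first by rewrite addn0.
  rewrite addnS; have [c1 c2 _] := uS (k + m)%N; split; last first.
    exact: leq_trans IH2 (ltnW c2).
  by move=> i iuk; rewrite c1 ?IH1 //; exact: leq_trans IH2.
(* The cylinder of stage [i.+1] has length at least [i.+1], so coordinate [i] no longer changes from
   that stage on. *)
pose x : baire := fun i => (u i.+1).1 i.
have ux k : cylinder (u k).1 (u k).2 x.
  move=> i iuk; rewrite /x; have [ki|ik] := leqP k i.+1.
    by rewrite -(subnKC ki); apply: (u_cyl k (i.+1 - k)%N).1.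
  rewrite -(subnKC (ltnW ik)); apply/esym; apply: (u_cyl i.+1 (k - i.+1)%N).1.
  exact: u_ge.
have [k _ Fkx] := OF x (n0O x (ux 0%N)).
by have [_ _ uF] := uS k; exact: uF (ux k.+1) Fkx.
Qed.

(** * Polishness of the Baire space and of binary products *)

Section polish_spaces.
Local Open Scope ring_scope.
Context {R : realType}.

Lemma natSinv_lt (e : R) : 0 < e -> exists n, n.+1%:R^-1 < e.
Proof.
move=> e0; have [n en] := ltr_add_invr e0.
by exists n; rewrite add0r in en.
Qed.

Lemma dist_ge0 (X : Type) (d : X -> X -> R) x y : is_metric d -> 0 <= d x y.
Proof.
case=> d0 _ dC dD; have := dD x y x; rewrite d0 (dC y x) -mulr2n.
by rewrite pmulrn_lge0.
Qed.

Lemma compatible_nbhsP (X : topologicalType) (d : X -> X -> R) :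
  compatible_metric d -> forall x (A : set X),
  nbhs x A <-> exists2 e : R, 0 < e & [set y | d x y < e] `<=` A.
Proof.
move=> [[d0 dsep dC dD] dopen] x A; split.
  rewrite nbhsE => -[B [/dopen oB Bx] BA].
  have [e e0 eB] := oB x Bx; exists e => //; exact: subset_trans BA.
move=> [e e0 eA]; apply: filterS eA _; apply: open_nbhs_nbhs; split; last first.
  by rewrite /= d0.
apply/dopen => y /= xye; exists (e - d x y); first by rewrite subr_gt0.
by move=> z /=; rewrite ltrBrDl; exact: le_lt_trans.
Qed.

Lemma compatible_ball_open (X : topologicalType) (d : X -> X -> R) x e :
  compatible_metric d -> open [set y | d x y < e].
Proof.
move=> dX; rewrite openE => y /= xye; apply/(compatible_nbhsP _ _ dX).
have [[_ _ _ dD] _] := dX; exists (e - d x y); first by rewrite subr_gt0.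
by move=> z /=; rewrite ltrBrDl; exact: le_lt_trans.
Qed.

Lemma baire_distP (a b : baire) :
  a = b /\ baire_dist R a b = 0 \/
  exists2 m, a m <> b m & baire_dist R a b = m.+1%:R^-1.
Proof.
rewrite /baire_dist; case: pselect => [ab|ab].
  by right; case: ex_minnP => m /eqP abm _; exists m.
left; split=> //; apply/funext => n; apply/eqP; apply: contra_notT ab => abn.
by exists n.
Qed.

Lemma baire_dist_lb (a b : baire) m : a m <> b m ->
  m.+1%:R^-1 <= baire_dist R a b.
Proof.
move=> /eqP abm; rewrite /baire_dist; case: pselect => [ab|[]]; last by exists m.
case: ex_minnP => k _ /(_ m abm) km.
by rewrite lef_pV2 ?posrE ?ltr0n// ler_nat.
Qed.

Lemma baire_dist_lt (a b : baire) n :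
  baire_dist R a b < n.+1%:R^-1 <-> cylinder a n.+1 b.
Proof.
split=> [abn i ltin|abn].
  apply/eqP; apply: contraPT abn => /eqP/nesym/baire_dist_lb abi.
  apply/negP; rewrite -leNgt; apply: le_trans abi.
  by rewrite lef_pV2 ?posrE ?ltr0n// ler_nat.
have [[_ ->]|[m abm ->]] := baire_distP a b; first by rewrite invr_gt0 ltr0n.
rewrite ltf_pV2 ?posrE ?ltr0n// ltr_nat ltnNge; apply: contra_notN abm => mn.
exact/esym/abn.
Qed.

Lemma baire_dist_metric : is_metric (baire_dist R).
Proof.
have dge0 a b : 0 <= baire_dist R a b.
  by have [[_ ->]|[m _ ->]] := baire_distP a b; rewrite ?invr_ge0.
split.
- by move=> a; have [[_ ->]|[m]] := baire_distP a a.
- move=> a b; have [[]//|[m _ ->] /eqP] := baire_distP a b.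
  by rewrite invr_eq0 pnatr_eq0.
- move=> a b; apply/le_anti/andP; split.
    have [[_ ->]|[m abm ->]] := baire_distP a b; first exact: dge0.
    by apply: baire_dist_lb; exact: nesym.
  have [[_ ->]|[m abm ->]] := baire_distP b a; first exact: dge0.
  by apply: baire_dist_lb; exact: nesym.
- move=> a b c; have [[_ ->]|[m acm ->]] := baire_distP a c.
    exact: addr_ge0.
  (* As [a m] and [c m] differ, [b m] differs from one of them, and that summand alone is at least
     [m.+1%:R^-1]. *)
  have [abm|/eqP abm] := eqVneq (a m) (b m).
    by rewrite -[leLHS]add0r lerD// baire_dist_lb// -abm.
  by rewrite -[leLHS]addr0 lerD// baire_dist_lb.
Qed.

Lemma baire_dist_compatible : compatible_metric (baire_dist R).
Proof.
split; first exact: baire_dist_metric.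
move=> A; rewrite openE; split=> oA a Aa.
  have /nbhs_baireP[n aA] := oA a Aa; exists n.+1%:R^-1.
    by rewrite invr_gt0 ltr0n.
  by move=> b /baire_dist_lt /(cylinder_le _ _ _ (leqnSn n)) /aA.
have [e e0 eA] := oA a Aa; have [n ne] := natSinv_lt e e0.
apply/nbhs_baireP; exists n.+1 => b /baire_dist_lt ab; apply: eA => /=.
exact: lt_trans ne.
Qed.

Lemma baire_dist_complete : complete_metric (baire_dist R).
Proof.
move=> u uC.
have /choice[N uN] (i : nat) : exists N, forall m n, (N <= m)%N -> (N <= n)%N ->
    baire_dist R (u m) (u n) < i.+1%:R^-1.
  by apply: uC; rewrite invr_gt0 ltr0n.
(* Terms closer than [i.+1%:R^-1] agree at coordinate [i], which is therefore constant from [N i]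
   on. *)
exists (fun i => u (N i) i); apply: cvg_baire => i; exists (N i) => // m /= im.
by have /baire_dist_lt := uN i _ _ (leqnn _) im; apply.
Qed.

Lemma polish_baire : polish R baire.
Proof.
split.
  exists (baire_dist R).
  by split; [exact: baire_dist_compatible|exact: baire_dist_complete].
(* The dense sequence enumerates the eventually zero points. *)
exists (fun k => nth 0%N (odflt [::] (unpickle k)) : baire).
move=> O [a Oa] oO; have [n nO] : exists n, cylinder a n `<=` O.
  by apply/nbhs_baireP; exact: open_nbhs_nbhs.
exists (nth 0%N (mkseq a n)); split; last first.
  by exists (pickle (mkseq a n)) => //; rewrite pickleK.
by apply: nO => i ltin; rewrite nth_mkseq.
Qed.

(** A presentation is constrained only on Polish spaces, while each level of [univ_G] adds a factor
    [baire]. The sum of the two metrics serves: it dominates both, so Cauchy sequences are Cauchy in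
    each coordinate. *)
Lemma polish_prod (X Y : topologicalType) :
  polish R X -> polish R Y -> polish R (X * Y)%type.
Proof.
move=> [[d [dX dXc]] [r rX]] [[e [eY eYc]] [s sY]]; split; last first.
  exists (fun k => let ij := odflt (0, 0)%N (unpickle k) in (r ij.1, s ij.2)).
  move=> O [[x y] Oxy] oO.
  have [[Q P] [/= nQ nP] QPO] : nbhs (x, y) O by exact: open_nbhs_nbhs.
  have [x' [/= Qx' [i _ rx]]] : (interior Q) `&` range r !=set0.
    by apply: rX; [exists x|exact: open_interior].
  have [y' [/= Py' [j _ sy]]] : (interior P) `&` range s !=set0.
    by apply: sY; [exists y|exact: open_interior].
  exists (r i, s j); split; last by exists (pickle (i, j)) => //; rewrite pickleK.
  by apply: QPO; rewrite rx sy; split; exact: interior_subset.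
have d_ge0 x y : 0 <= d x y by apply: dist_ge0; case: dX.
have e_ge0 x y : 0 <= e x y by apply: dist_ge0; case: eY.
exists (fun p q => d p.1 q.1 + e p.2 q.2); split.
  have [[d0 dsep dC dD] _] := dX; have [[e0 esep eC eD] _] := eY.
  split; first split.
  - by move=> p; rewrite d0 e0 addr0.
  - move=> [x y] [x' y'] /= /eqP; rewrite paddr_eq0// => /andP[/eqP/dsep-> /eqP].
    by move=> /esep->.
  - by move=> p q; rewrite dC eC.
  - by move=> p q t; rewrite addrACA lerD.
  move=> A; rewrite openE; split=> oA [x y] Axy.
    have [[Q P] [/=]] := oA _ Axy.
    move=> /(compatible_nbhsP _ _ dX)[a a0 aQ].
    move=> /(compatible_nbhsP _ _ eY)[b b0 bP] QPA.
    exists (Num.min a b); first by rewrite lt_min a0.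
    move=> [x' y'] /=; rewrite lt_min => /andP[xa yb]; apply: QPA; split=> /=.
      by apply: aQ => /=; apply: le_lt_trans xa; rewrite lerDl.
    by apply: bP => /=; apply: le_lt_trans yb; rewrite lerDr.
  have [a a0 aA] := oA _ Axy; have a20 : 0 < a / 2 by rewrite divr_gt0.
  exists ([set x' | d x x' < a / 2], [set y' | e y y' < a / 2]).
    split; first by apply/(compatible_nbhsP _ _ dX); exists (a / 2).
    by apply/(compatible_nbhsP _ _ eY); exists (a / 2).
  move=> [x' y'] /= [xa ya]; apply: aA => /=.
  by rewrite [ltRHS]splitr ltrD.
move=> u uC.
have [x ux] : exists x : X, (fun n => (u n).1) @ \oo --> x.
  apply: dXc => a /uC[N uN]; exists N => m n Nm Nn.
  by apply: le_lt_trans (uN _ _ Nm Nn); rewrite lerDl.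
have [y uy] : exists y : Y, (fun n => (u n).2) @ \oo --> y.
  apply: eYc => a /uC[N uN]; exists N => m n Nm Nn.
  by apply: le_lt_trans (uN _ _ Nm Nn); rewrite lerDr.
exists (x, y); rewrite [u](_ : _ = fun n => ((u n).1, (u n).2)).
  exact: cvg_pair.
by apply/funext => n; exact: surjective_pairing.
Qed.

End polish_spaces.

(** * Prime-power coding of finite sequences *)

Lemma nth_prime_prime n : prime (nth_prime n).
Proof. by case: n => [|n] //=; case: ex_minnP => p /andP[]. Qed.

Lemma nth_prime_ltn : {homo nth_prime : m n / (m < n)%N}.
Proof.
apply: homo_ltn; first exact: ltn_trans.
by move=> n /=; case: ex_minnP => p /andP[].
Qed.

Lemma nth_prime_eq i j : (nth_prime i == nth_prime j) = (i == j).
Proof.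
apply/eqP/eqP => [|->//].
by case: (ltngtP i j) => // /nth_prime_ltn + ij; rewrite ij ltnn.
Qed.

Lemma logn_seq_code (u : seq nat) i :
  logn (nth_prime i) (seq_code u) =
    if (i < size u)%N then (nth 0 u i).+1 else 0.
Proof.
have lognE (j : nat) e :
    logn (nth_prime i) (nth_prime j ^ e) = if i == j then e else 0%N.
  rewrite lognX logn_prime ?nth_prime_prime// nth_prime_eq eq_sym.
  by case: eqP; rewrite ?muln1 ?muln0.
rewrite /seq_code; set F := fun j : nat => (nth_prime j ^ (nth 0 u j).+1)%N.
suff -> n : logn (nth_prime i) (\prod_(j < n) F j) =
    if (i < n)%N then (nth 0 u i).+1 else 0 by [].
elim: n => [|n IHn]; first by rewrite big_ord0 logn1.
rewrite big_ord_recr lognM ?IHn ?lognE ?ltnS.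
- by case: ltngtP => [_|_|->]; rewrite ?addn0.
- by apply: prodn_gt0 => j; rewrite expn_gt0 prime_gt0 ?nth_prime_prime.
- by rewrite expn_gt0 prime_gt0 ?nth_prime_prime.
Qed.

(** Exponents are entries plus one, hence positive exactly below the length: they determine the
    length first, then the entries. *)
Lemma seq_code_inj : injective seq_code.
Proof.
move=> u v uv.
have E i := etrans (esym (logn_seq_code u i))
  (etrans (congr1 (logn (nth_prime i)) uv) (logn_seq_code v i)).
have suv : size u = size v.
  case: (ltngtP (size u) (size v)) => // ltuv.
    by have := E (size u); rewrite ltuv ltnn.
  by have := E (size v); rewrite ltuv ltnn.
apply: (@eq_from_nth _ 0%N) => // i iu; have := E i.
by rewrite -suv iu => -[].
Qed.

Lemma entry_seq_code (u : seq nat) i : entry (seq_code u) i = nth 0%N u i.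
Proof.
rewrite /entry /seq_decode; congr nth.
by case: xgetP => [v _ /seq_code_inj//|/(_ u)]; case.
Qed.

(** * Continuity of maps between products *)

Lemma continuous_fst (X Y : topologicalType) : continuous (@fst X Y).
Proof. by move=> p; exact: cvg_fst. Qed.

Lemma continuous_snd (X Y : topologicalType) : continuous (@snd X Y).
Proof. by move=> p; exact: cvg_snd. Qed.

Lemma continuous_compose (X Y Z : topologicalType) (f : X -> Y) (g : Y -> Z) :
  continuous f -> continuous g -> continuous (fun x => g (f x)).
Proof. by move=> cf cg x; apply: continuous_comp; [exact: cf|exact: cg]. Qed.

Lemma continuous_pair (X Y Z : topologicalType) (f : X -> Y) (g : X -> Z) :
  continuous f -> continuous g -> continuous (fun x => (f x, g x)).
Proof. by move=> cf cg x; apply: cvg_pair; [exact: cf|exact: cg]. Qed.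

(** This is the shape that a substitution [h] takes under one more quantifier, whose variable is
    left unchanged. *)
Lemma continuous_param (X Y Z T : topologicalType) (h : X * Y -> Z) :
  continuous h ->
  continuous (fun p : X * (Y * T) => (h (p.1, p.2.1), p.2.2)).
Proof.
move=> ch; apply: continuous_pair; last first.
  by apply: continuous_compose; exact: continuous_snd.
apply: continuous_compose ch; apply: continuous_pair.
  exact: continuous_fst.
apply: continuous_compose; first exact: continuous_snd.
exact: continuous_fst.
Qed.

(** * Universal sets and substitution in their parameters *)

Section codes.
Local Open Scope ring_scope.
Context {R : realType} (S : presentation R).
Implicit Types X Y : ptopologicalType.

Definition ball_code (i m : nat) : nat := seq_code [:: i; seq_code [:: 1; m]]%N.

(** A ball of radius 0/1: the filler where a parameter has no ball to list. *)
Definition empty_code : nat := seq_code [:: 0; seq_code [:: 0; 0]]%N.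

Lemma basic_open_ball_code X i m :
  basic_open S X (ball_code i m) = [set x | pdist S (pseq S X i) x < m.+1%:R^-1].
Proof.
by rewrite /basic_open /ball_code /radius !entry_seq_code /= div1r.
Qed.

Lemma open_basic_open X s : polish R X -> open (basic_open S X s).
Proof. by move=> /(pdist_compatible S) /compatible_ball_open; exact. Qed.

Lemma basic_open_empty_code X : polish R X -> basic_open S X empty_code = set0.
Proof.
move=> pX; apply/seteqP; split=> // x.
rewrite /basic_open /empty_code /radius !entry_seq_code /= mul0r ltNge.
by have [dX _] := pdist_compatible S pX; rewrite dist_ge0.
Qed.

(** Take a center from the dense sequence at distance less than [m.+1%:R^-1 < e / 2] from [x]: the
    ball of that radius around it contains [x] and stays within [e] of [x]. *)
Lemma basic_open_nbhs X x (A : set X) : polish R X -> nbhs x A ->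
  exists2 s, basic_open S X s x & basic_open S X s `<=` A.
Proof.
move=> pX; have dX := pdist_compatible S pX.
have [[_ _ dC dD] _] := dX.
move=> /(compatible_nbhsP _ _ dX)[e e0 eA].
have [m me] := natSinv_lt (e / 2) (divr_gt0 e0 (ltr0Sn _ _)).
have [y [/= xy [i _ ry]]] :
    [set y | pdist S x y < m.+1%:R^-1] `&` range (pseq S X) !=set0.
  apply: (pseq_dense S pX); last exact: compatible_ball_open.
  exists x => /=; have [[d0 _ _ _] _] := dX.
  by rewrite d0 invr_gt0 ltr0n.
exists (ball_code i m); rewrite basic_open_ball_code /= ry.
  by rewrite dC.
move=> z /= yz; apply: eA => /=; apply: le_lt_trans (dD _ y _) _.
by rewrite [ltRHS]splitr ltrD// (lt_trans _ me).
Qed.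

Lemma open_univ_U X : polish R X -> open (univ_U S X).
Proof.
move=> pX; rewrite openE => -[a x] [n /= ax].
exists ([set b : baire | b n = a n], basic_open S X (a n)) => /=.
  split; first exact: nbhs_coord.
  by apply: open_nbhs_nbhs; split => //; exact: open_basic_open.
by move=> [b y] /= [ban ay]; exists n; rewrite /= ban.
Qed.

(** [O] is a union of products of a cylinder and a ball. The parameter [g a] lists the balls whose
    cylinder contains [a]; each test reads a finite part of [a], whence continuity. *)
Lemma univ_U_param (Z : ptopologicalType) (O : set (baire * Z)) :
  polish R Z -> open O ->
  exists2 g : baire -> baire, continuous g &
    forall a z, univ_U S Z (g a, z) <-> O (a, z).
Proof.
move=> pZ oO.
(* The pair [us] is a finite sequence and a ball code: [a] extends the sequence, and the cylinder
   times the ball lies inside [O]. *)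
pose good (a : baire) (us : seq nat * nat) :=
  (forall i, (i < size us.1)%N -> a i = nth 0%N us.1 i) /\
  forall b z, (forall i, (i < size us.1)%N -> b i = nth 0%N us.1 i) ->
    basic_open S Z us.2 z -> O (b, z).
pose g (a : baire) : baire := fun k =>
  if unpickle k is Some us then if `[< good a us >] then us.2 else empty_code
  else empty_code.
exists g.
  apply: continuous_baire => a k; rewrite /g.
  case: (unpickle k) => [us|]; last by exists 0%N.
  exists (size us.1) => b ab.
  suff -> : good b us = good a us by [].
  apply/propext; split=> -[ua uO]; split=> // i iu; first by rewrite -ab// ua.
  by rewrite ab// ua.
move=> a z; split.
  move=> [k /=]; rewrite /g; case: unpickle => [us|]; last first.
    by rewrite basic_open_empty_code.
  case: asboolP => [[ua uO] /(uO a)|_]; last by rewrite basic_open_empty_code.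
  exact.
move=> Oaz; have [[Q P] /= [/nbhs_baireP[n aQ] nP] QPO] : nbhs (a, z) O.
  exact: open_nbhs_nbhs.
have [s sz sP] := basic_open_nbhs Z z P pZ nP.
exists (pickle (mkseq a n, s)); rewrite /= /g pickleK.
case: asboolP => // -[]; split=> /=.
  by move=> i; rewrite size_mkseq => ilt; rewrite nth_mkseq.
move=> b y bu sy; apply: QPO; split=> /=; last exact: sP.
by apply: aQ => i ilt; rewrite bu ?size_mkseq// nth_mkseq.
Qed.

Lemma univ_GS n X a x : univ_G S n.+2 X (a, x) <->
  exists g, ~ univ_G S n.+1 (X * baire)%type (a, (x, g)).
Proof. by []. Qed.

Lemma univ_G1 X a x : univ_G S 1 X (a, x) <->
  exists g, ~ univ_U S (X * baire)%type (a, (x, g)).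
Proof. by []. Qed.

(** An s-m-n theorem. At the first level the open matrix is pulled back along a continuous map and
    [univ_U_param] applies; above it, [h] is extended by the quantified variable, and the
    equivalence passes through negation and projection. *)
Lemma univ_G_param n X Y (h : baire * X -> Y) :
  polish R X -> polish R Y -> continuous h ->
  exists2 g : baire -> baire, continuous g &
    forall a x, univ_G S n.+1 X (g a, x) <-> univ_G S n.+1 Y (a, h (a, x)).
Proof.
elim: n X Y h => [|n IHn] X Y h pX pY ch.
  pose k (p : baire * (X * baire)) := (p.1, (h (p.1, p.2.1), p.2.2)).
  have ck : continuous k.
    apply: continuous_pair; first exact: continuous_fst.
    exact: continuous_param.
  have [g cg gO] := univ_U_param _ (k @^-1` univ_U S (Y * baire)%type)
    (polish_prod _ _ pX polish_baire)
    (open_comp (fun x _ => ck x)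
      (open_univ_U _ (polish_prod _ _ pY polish_baire))).
  exists g => // a x; rewrite !univ_G1; split=> -[c nc]; exists c => Gc.
    exact/nc/(gO a (x, c)).2.
  exact/nc/(gO a (x, c)).1.
pose k (p : baire * (X * baire)) := (h (p.1, p.2.1), p.2.2).
have ck : continuous k by exact: continuous_param.
have [g cg gO] := IHn _ _ k (polish_prod _ _ pX polish_baire)
  (polish_prod _ _ pY polish_baire) ck.
exists g => // a x; rewrite !univ_GS; split=> -[c nc]; exists c => Gc.
  exact/nc/(gO a (x, c)).2.
exact/nc/(gO a (x, c)).1.
Qed.

Lemma univ_G_universal n X (A : set X) : polish R X -> Sigma1 n.+1 A ->
  exists a, forall x, univ_G S n.+1 X (a, x) <-> A x.
Proof.
elim: n X A => [|n IHn] X A pX.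
  move=> [C cC ->].
  have [g _ gC] := univ_U_param (X * baire)%type (snd @^-1` ~` C)
    (polish_prod _ _ pX polish_baire)
    (open_comp (fun p _ => continuous_snd _ _ p) (closed_openC cC)).
  (* The open set was made constant in its parameter, so any argument of [g] would do. *)
  exists (g (fun=> 0%N)) => x; rewrite univ_G1; split=> [[c]|[[y c] Cxc /= <-]].
    by move=> /gC /contrapT Cxc; exists (x, c).
  by exists c => /gC.
move=> [C sC ->].
have [a aC] := IHn (X * baire)%type (~` C) (polish_prod _ _ pX polish_baire) sC.
exists a => x; rewrite univ_GS; split=> [[c]|[[y c] Cxc /= <-]].
  by move=> /aC /contrapT Cxc; exists (x, c).
by exists c => /aC.
Qed.

End codes.

(** * Diagonalization against [f] *)

Theorem theorem10 (R : realType) (S : presentation R) (n : nat)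
    (hn : (1 <= n)%N) (f : baire -> baire) (hf : Delta1_measurable n f) :
  exists a : baire,
    ~ meager (xsection (univ_G S n baire) a `+`
              xsection (univ_U S baire) (f a)).
Proof.
case: n hn hf => // n _ hf; apply: contrapT => /forallNP nm.
have {nm} meagerD a : meager (xsection (univ_G S n.+1 baire) a `+`
    xsection (univ_U S baire) (f a)) by exact: contrapT (nm a).
have pN : polish R baire := polish_baire.
(* Substituting [fst] makes membership in the section at [g a] independent of the point: it means
   [univ_G] at [(a, a)]. *)
have [g cg gG] := univ_G_param S n baire baire fst pN pN
  (continuous_fst baire baire).
pose V : set baire := [set b | xsection (univ_U S baire) b !=set0].
have oV : open V.
  rewrite (_ : V = fst @` univ_U S baire); first exact/fst_open/open_univ_U.
  apply/seteqP; split=> [b [x /xsectionP Ubx]|_ [[b x] Ubx <-]].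
    by exists (b, x).
  by exists x; apply/xsectionP.
have Vfg a : V (f (g a)) <-> univ_G S n.+1 baire (a, a).
  have := meagerD (g a).
  set U := xsection _ (f (g a)); set G := xsection _ (g a) => mGU.
  have oU : open U.
    rewrite /U (_ : xsection _ _ = (fun x => (f (g a), x)) @^-1` univ_U S baire).
      apply: open_comp (open_univ_U S _ pN) => x _.
      by apply: (continuous_pair _ _ _ (fun=> f (g a)) id) => y;
        [exact: cvg_cst|exact: cvg_id].
    by apply/seteqP; split=> x /xsectionP.
  (* If exactly one of the two sections is nonempty, it lies in the symmetric difference; being open
     ([U]) or everything ([G]), it cannot be meager. *)
  split=> [[x Ux]|Gaa].
    apply: contrapT => nGaa; suff U0 : U = set0 by rewrite -/U U0 in Ux.
    by apply: meager_open_eq0 mGU oU _ => y Uy; right; split=> // /xsectionP /gG.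
  apply: contrapT => nV.
  have T0 : [set: baire] = set0.
    apply: meager_open_eq0 mGU openT _ => y _; left; split.
      by apply/xsectionP/gG.
    by move=> Uy; apply: nV; exists y.
  by have : [set: baire] point by []; rewrite T0.
(* The [Pi1] half of measurability provides a parameter [e] for the complement of the preimage of
   [V]. *)
have [_ sfV] := hf V oV.
have [e eV] := univ_G_universal S n baire _ pN sfV.
(* Here [g] acts on the point rather than the parameter, so the section at [g' e] consists of the
   [a] with [f (g a)] outside [V]; at [a = g' e] this contradicts [Vfg]. *)
have [g' _ g'G] := univ_G_param S n baire baire (fun p => g p.2) pN pN
  (continuous_compose _ _ _ _ _ (continuous_snd baire baire) cg).
have diag : univ_G S n.+1 baire (g' e, g' e) <-> ~ V (f (g (g' e))).
  by apply: iff_trans (g'G _ _) _; exact: eV.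
by have := Vfg (g' e); tauto.
Qed.
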